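(* Given nonzero subspaces $V,W\subset X$ and a subspace $U\subset V$, let $r=\dim U$, $p=\dim V$, and let $V_{\mathbf{i}}$, $\mathbf{i}\in\mathcal{I}_r^p$, be the coordinate $r$-subspaces of a principal basis of $V$ with respect to $W$. Then $$\cos^2\Theta_{U,W}=\sum_{\mathbf{i}\in\mathcal{I}_r^p}\cos^2\Theta_{U,V_{\mathbf{i}}}\cdot\cos^2\Theta_{V_{\mathbf{i}},W}.$$
   Context: $X$ is an $n$-dimensional vector space over $\mathbb{R}$ (real case) or $\mathbb{C}$ (complex case) with an inner product $\langle\cdot,\cdot\rangle$ (Hermitian in the complex case, conjugate-linear in the left entry). Subspaces and dimensions are over the same field. Principal angles and bases: for nonzero subspaces $V,W\subset X$, with $p=\dim V$, $q=\dim W$, $m=\min\{p,q\}$, orthonormal bases $(e_1,\dots,e_p)$ of $V$ and $(f_1,\dots,f_q)$ of $W$ are associated principal bases, with principal angles $0\le\theta_1\le\dots\le\theta_m\le\frac{\pi}{2}$, if $\langle e_i,f_j\rangle=\delta_{ij}\cos\theta_i$ (equal to $0$ whenever $i\neq j$). Such bases always exist and the $\theta_i$ are uniquely determined. A principal basis of $V$ with respect to $W$ is a basis $(e_1,\dots,e_p)$ of $V$ belonging to such a pair. Grassmann angle: for nonzero subspaces $V,W\subset X$ with principal angles $\theta_1,\dots,\theta_m$, the Grassmann angle $\Theta_{V,W}\in[0,\frac{\pi}{2}]$ of $V$ with $W$ is $\Theta_{V,W}=\arccos(\cos\theta_1\cdots\cos\theta_m)$ if $\dim V\le\dim W$, and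 $\Theta_{V,W}=\frac{\pi}{2}$ if $\dim V>\dim W$. Also $\Theta_{\{0\},\{0\}}=\Theta_{\{0\},V}=0$ and $\Theta_{V,\{0\}}=\frac{\pi}{2}$ for $V\ne\{0\}$. For integers $1\le r\le p$, $\mathcal{I}_r^p=\{(i_1,\dots,i_r)\in\mathbb{N}^r:1\le i_1<\dots<i_r\le p\}$, and $\mathcal{I}_0^p=\{0\}$. For a basis $(e_1,\dots,e_p)$ of $V$, its coordinate $r$-subspaces are $V_{\mathbf{i}}=\operatorname{span}(e_{i_1},\dots,e_{i_r})$, $\mathbf{i}=(i_1,\dots,i_r)\in\mathcal{I}_r^p$, and the coordinate $0$-subspace is $V_0=\{0\}$. *)

(* Defs.v *)
From mathcomp Require Import all_boot all_order all_algebra.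
From mathcomp Require Import boolp classical_sets reals trigo.
From mathcomp Require Import complex.

Set Implicit Arguments.
Unset Strict Implicit.
Unset Printing Implicit Defensive.

Import Order.TTheory GRing.Theory Num.Theory.
Local Open Scope ring_scope.
Local Open Scope classical_set_scope.

(* The scalar field K is either R, with theta and iota the identity, or R[i],
   with theta the complex conjugation and iota the embedding of R in R[i]. *)
Section GrassmannAngle.
Context {R : realType} {K : numFieldType} (iota : R -> K)
  {theta : {rmorphism K -> K}} {X : vectType K} (ip : {dot X for theta}).

(* A {dot X for theta} is theta-linear in its right argument; the inner product
   <u, v> here is theta-linear in its left argument. *)
Local Notation "''[' u , v ]" := (ip v u) : ring_scope.

(* When i = j, i is less than minn (\dim V) (\dim W), so that the default value
   of th`_i is never used. *)
Definition principal_bases (V W : {vspace X})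
    (e : (\dim V).-tuple X) (f : (\dim W).-tuple X)
    (th : (minn (\dim V) (\dim W)).-tuple R) : Prop :=
  [/\ basis_of V e /\ orthonormal ip e,
      basis_of W f /\ orthonormal ip f,
      sorted <=%R th /\ {in th, forall t, 0 <= t <= pi / 2} &
      forall (i : 'I_(\dim V)) (j : 'I_(\dim W)),
        '[tnth e i, tnth f j] = if i == j :> nat then iota (cos th`_i) else 0].

Definition principal_basis (V W : {vspace X}) (e : (\dim V).-tuple X) : Prop :=
  exists f th, @principal_bases V W e f th.

(* Principal bases always exist and determine the angles; the default value of
   xget is not meaningful. *)
Definition principal_angles (V W : {vspace X}) :
    (minn (\dim V) (\dim W)).-tuple R :=
  xget [tuple 0 | _ < _] [set th | exists e f, @principal_bases V W e f th].

(* The case V != 0, W = 0 falls under \dim V > \dim W. *)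
Definition grassmann_angle (V W : {vspace X}) : R :=
  if V == 0%VS then 0
  else if (\dim V <= \dim W)%N
  then acos (\prod_(t <- principal_angles V W) cos t)
  else pi / 2.

End GrassmannAngle.

Definition coordinate_subspace (K : fieldType) (X : vectType K) (p r : nat)
    (e : p.-tuple X) (i : r.-tuple 'I_p) : {vspace X} :=
  <<[seq tnth e j | j <- i]>>%VS.

Definition increasing (p r : nat) (i : r.-tuple 'I_p) : bool :=
  sorted ltn [seq val j | j <- i].

(* Main.v *)
Require Import Defs.
From HB Require Import structures.
From mathcomp Require Import all_boot all_order all_algebra perm.
From mathcomp Require Import reals trigo complex.

Set Implicit Arguments.
Unset Strict Implicit.
Unset Printing Implicit Defensive.

Import Order.TTheory GRing.Theory Num.Theory.
Local Open Scope ring_scope.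

(** Let G be the matrix of inner products between an orthonormal basis of V and
    one of W. The squared cosine of the Grassmann angle of V with W is the
    determinant of G G^*, with G^* the conjugate transpose: on principal bases
    G is diagonal with the cosines of the principal angles as entries, and a
    change of orthonormal bases multiplies G on both sides by unitary matrices,
    which leaves the determinant unchanged (sqr_cos_grassmann_angle). If
    dim V > dim W, then G G^* is singular, and if V = 0, then it is empty, so
    the formula also covers the degenerate values of the angle.

    Now let e, f be principal bases of V and W, let u be an orthonormal basis of
    U, let A be the matrix of inner products of u with e, and D that of e with
    f. Since U lies in V, the matrix for U and W is A D, so its squared cosine
    is det (A (D D^* ) A^* ). The Cauchy-Binet formula expands this determinant
    over the sets t of r = dim U columns of A. As D D^* is diagonal, the term of
    such a subset t is the product of det A_t, of the principal minor of D D^*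
    on t, and of det A_t^*. The outer factors give the squared cosine for U and
    the coordinate subspace of t, the minor that for this coordinate subspace
    and W.

    The Grassmann angle is computed from chosen principal angles, so one also
    needs that principal bases exist (principal_bases_exist). They come from
    diagonalising, on V, the orthogonal projection P onto W
    (selfadjoint_diagonal): if e is an orthonormal basis of V whose images P e_i
    are pairwise orthogonal, the nonzero P e_i, once normalised, start the basis
    of W, and the cosines are the lengths of the P e_i.

    The real and the complex case differ only in the reason why a self-adjoint
    matrix has an eigenvalue; everything before symmetric_eigenvalue treats them
    together. *)

(** * The Cauchy-Binet formula *)
Section CauchyBinet.
Context {R : comNzRingType} {m n : nat}.
Implicit Types (A : 'M[R]_(m, n)) (C : 'M[R]_(n, m)).

(** The determinant is multilinear in the rows of the product, and each of them
    is a combination of rows of C; f records which row of C is taken for each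
    row of the product. *)
Lemma det_mulmx_ffun A C :
  \det (A *m C) =
    \sum_(f : {ffun 'I_m -> 'I_n}) (\prod_i A i (f i)) * \det (rowsub f C).
Proof.
have -> : \det (A *m C) = \sum_(s : 'S_m) \sum_(f : {ffun 'I_m -> 'I_n})
    (-1) ^+ s * \prod_i (A i (f i) * C (f i) (s i)).
  apply: eq_bigr => s _; rewrite -mulr_sumr; congr (_ * _).
  under eq_bigr do rewrite mxE.
  by rewrite bigA_distr_bigA.
rewrite exchange_big; apply: eq_bigr => f _ /=.
rewrite mulr_sumr; apply: eq_bigr => s _.
rewrite big_split /= mulrCA; congr (_ * (_ * _)).
by apply: eq_bigr => i _; rewrite mxE.
Qed.

Lemma det_rowsub_noninjective C (f : 'I_m -> 'I_n) :
  ~~ injectiveb f -> \det (rowsub f C) = 0.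
Proof.
move/injectivePn => [i [j ne_ij eq_fij]].
by apply: (determinant_alternate ne_ij) => k; rewrite !mxE eq_fij.
Qed.

Lemma det_rowsub_perm C (f : 'I_m -> 'I_n) (s : 'S_m) :
  \det (rowsub (f \o s) C) = (-1) ^+ s * \det (rowsub f C).
Proof. by rewrite rowsub_comp -row_permEsub row_permE det_mulmx det_perm. Qed.

Lemma increasing_uniq (t : m.-tuple 'I_n) : increasing t -> uniq t.
Proof.
move=> t_incr; rewrite -(map_inj_uniq val_inj).
exact: (sorted_uniq ltn_trans ltnn).
Qed.

Definition ord_leq : rel 'I_n := relpre val leq.

(** The increasing enumeration of the range of an injective f, by which the
    functions with a given range are grouped. *)
Definition sort_ffun (f : {ffun 'I_m -> 'I_n}) : m.-tuple 'I_n :=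
  sort_tuple ord_leq [tuple f i | i < m].

Lemma sorted_increasing (t : m.-tuple 'I_n) :
  increasing t = uniq t && sorted ord_leq t.
Proof.
by rewrite /increasing ltn_sorted_uniq_leq (map_inj_uniq val_inj) sorted_map.
Qed.

Lemma increasing_sort_ffun (f : {ffun _}) :
  injectiveb f -> increasing (sort_ffun f).
Proof.
move=> /injectiveP f_inj; rewrite sorted_increasing sort_uniq /=.
rewrite (map_inj_uniq f_inj) enum_uniq sort_sorted // => i j; exact: leq_total.
Qed.

(** The injective functions with range t are the enumeration t precomposed with
    a permutation, so the sum over them becomes a Leibniz sum. *)
Lemma sort_ffunP (t : m.-tuple 'I_n) (f : {ffun 'I_m -> 'I_n}) :
  increasing t ->
  reflect (exists s : 'S_m, f = [ffun i => tnth t (s i)])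
          (injectiveb f && (sort_ffun f == t)).
Proof.
move=> t_incr; have := t_incr; rewrite sorted_increasing => /andP[t_uniq t_sort].
apply: (iffP andP) => [[f_inj /eqP sort_f]|[s ->]].
  have: perm_eq [tuple f i | i < m] t by rewrite -sort_f perm_sym perm_sort.
  case/tuple_permP => s /val_inj Es; exists s; apply/ffunP => i.
  by rewrite ffunE -[f i](tnth_mktuple f) Es tnth_mktuple.
split.
  apply/injectiveP => i j; rewrite !ffunE => /(tuple_uniqP _ t_uniq)/perm_inj.
  exact.
apply/eqP/val_inj/(@sorted_eq _ ord_leq) => //.
- by move=> ? ? ?; apply: leq_trans.
- by move=> i j /anti_leq/val_inj.
- by apply: sort_sorted => i j; apply: leq_total.
rewrite perm_sort; apply/tuple_permP; exists s.
by congr val; apply: eq_from_tnth => i; rewrite !tnth_mktuple ffunE.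
Qed.

Lemma Cauchy_Binet A C :
  \det (A *m C) = \sum_(t : m.-tuple 'I_n | increasing t)
    \det (colsub (tnth t) A) * \det (rowsub (tnth t) C).
Proof.
rewrite det_mulmx_ffun (bigID (fun f : {ffun _} => injectiveb f)) /=.
rewrite [X in _ + X]big1 ?addr0; last first.
  by move=> f /det_rowsub_noninjective ->; rewrite mulr0.
rewrite (partition_big sort_ffun (@increasing n m)) /=; last first.
  exact: increasing_sort_ffun.
apply: eq_bigr => t t_incr.
pose h (s : 'S_m) : {ffun 'I_m -> 'I_n} := [ffun i => tnth t (s i)].
rewrite (eq_bigl [in [set h s | s : 'S_m]]) => [|f]; last first.
  apply/(sort_ffunP f t_incr)/imsetP => [[s ->]|[s _ ->]]; by exists s.
rewrite big_imset /=; last first.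
  move=> s1 s2 _ _ /ffunP eq_h; apply/permP => i.
  by have := eq_h i; rewrite !ffunE => /(tuple_uniqP _ (increasing_uniq t_incr)).
(* The signs of the permuted minors of C turn the sum of the products of entries
   of A into the determinant of its columns t. *)
rewrite mulr_suml; apply: eq_big => [s|s _]; first by rewrite inE.
rewrite (eq_rowsub (tnth t \o s)) => [|i]; last by rewrite ffunE.
rewrite det_rowsub_perm mulrCA mulrA; congr (_ * _ * _).
by apply: eq_bigr => i _; rewrite mxE ffunE.
Qed.

End CauchyBinet.

Lemma det_mulmx_lt (F : fieldType) m n (A : 'M[F]_(m, n)) (B : 'M[F]_(n, m)) :
  (n < m)%N -> \det (A *m B) = 0.
Proof.
move=> lt_nm; apply/eqP/negPn/negP => det_neq0.
have : row_free (A *m B) by rewrite row_free_unit unitmxE unitfE.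
rewrite /row_free => /eqP rk; have := leq_trans (mxrankM_maxl A B) (rank_leq_col A).
by rewrite rk leqNgt lt_nm.
Qed.

(** Multiplication by a diagonal matrix acts on each row separately, so it
    commutes with the selection of rows. *)
Lemma rowsub_diag_mul (R : comNzRingType) m n k (d : 'rV[R]_n)
    (C : 'M[R]_(n, m)) (t : k.-tuple 'I_n) :
  uniq t ->
  rowsub (tnth t) (diag_mx d *m C) =
    mxsub (tnth t) (tnth t) (diag_mx d) *m rowsub (tnth t) C.
Proof.
move=> /tuple_uniqP t_inj.
have -> : mxsub (tnth t) (tnth t) (diag_mx d) = diag_mx (\row_i d 0 (tnth t i)).
  by apply/matrixP => i j; rewrite !mxE (inj_eq t_inj).
by apply/matrixP => i j; rewrite mxE !mul_diag_mx !mxE.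
Qed.

(** * Gram matrices, orthogonal projections and orthonormal bases *)

(** For a symmetric relation the order of the sequence is irrelevant, which
    allows an orthonormal sequence to be permuted. *)
Lemma uniq_pairwiseP (T : eqType) (r : rel T) (s : seq T) :
  symmetric r -> uniq s ->
  reflect {in s &, forall x y, x != y -> r x y} (pairwise r s).
Proof.
move=> r_sym; elim: s => [_|x s IHs /=]; first exact: ReflectT.
case/andP=> xNs /IHs {}IHs; apply: (iffP andP) => [[/allP rx /IHs rs]|rxs].
  move=> y z; rewrite !inE => /predU1P[->|ys] /predU1P[->|zs]; first by rewrite eqxx.
  - by move=> _; apply: rx.
  - by move=> _; rewrite r_sym; apply: rx.
  - exact: rs.
split; last first.
  by apply/IHs => y z ys zs; apply: rxs; rewrite inE ?ys ?zs orbT.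
apply/allP => y ys; apply: rxs; rewrite ?inE ?eqxx ?ys ?orbT //.
by apply: contraNneq xNs => ->.
Qed.

Section InnerProduct.
Context {K : numFieldType} {theta : {rmorphism K -> K}} {X : vectType K}
  (ip : {dot X for theta}).
Implicit Types (s t : seq X) (x y : X) (V W : {vspace X}).

Definition gram m n (u : m.-tuple X) (w : n.-tuple X) : 'M[K]_(m, n) :=
  \matrix_(i, j) ip (tnth u i) (tnth w j).

Lemma ipC x y : ip x y = theta (ip y x).
Proof. by rewrite hermC expr0 mul1r. Qed.

Lemma ip_eq0C x y : (ip x y == 0) = (ip y x == 0).
Proof. exact: herm_eq0C. Qed.

Lemma ip_gt0 x : (0 < ip x x) = (x != 0).
Proof.
have [->|x_neq0] := eqVneq x 0; first by rewrite linear0l ltxx.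
exact: neq0_dnorm_gt0.
Qed.

Lemma ip_ge0 x : 0 <= ip x x.
Proof.
have [->|] := eqVneq x 0; first by rewrite linear0l.
by rewrite -ip_gt0 => /ltW.
Qed.

Lemma ip_eq0 x : (ip x x == 0) = (x == 0).
Proof.
have [->|] := eqVneq x 0; first by rewrite linear0l eqxx.
by rewrite -ip_gt0 => /gt_eqF.
Qed.

Lemma ipZl a x y : ip (a *: x) y = a * ip x y.
Proof. exact: linearZl_LR. Qed.

Lemma ipZr a x y : ip x (a *: y) = theta a * ip x y.
Proof. exact: linearZr_LR. Qed.

Lemma ipBl x y z : ip (x - y) z = ip x z - ip y z.
Proof. exact: linearBl. Qed.

Lemma ipBr x y z : ip x (y - z) = ip x y - ip x z.
Proof. exact: linearBr. Qed.

Lemma orthonormal_pairwise s :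
  orthonormal ip s =
    all (fun x => ip x x == 1) s && pairwise (fun x y => ip x y == 0) s.
Proof.
rewrite /orthonormal; congr (_ && _).
by elim: s => //= x s ->; rewrite andbT.
Qed.

Lemma orthonormal_cat s t :
  orthonormal ip (s ++ t) =
    [&& orthonormal ip s, orthonormal ip t & allrel (fun x y => ip x y == 0) s t].
Proof.
rewrite !orthonormal_pairwise all_cat pairwise_cat.
by case: (all _ s); case: (all _ t); case: (pairwise _ s); case: (pairwise _ t);
  case: allrel.
Qed.

Lemma orthonormal_gramP n (u : n.-tuple X) :
  reflect (gram u u = 1%:M) (orthonormal ip u).
Proof.
rewrite orthonormal_pairwise; apply: (iffP andP) => [[/allP nu /pairwiseP ou]|Gu].
  apply/matrixP => i j; rewrite !mxE.
  have [->|ne_ij] := eqVneq i j; first by apply/eqP/nu/mem_tnth.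
  apply/eqP; rewrite !(tnth_nth 0).
  have [lt_ij|lt_ji|/val_inj eq_ij] := ltngtP i j; last by rewrite eq_ij eqxx in ne_ij.
    by apply: (ou 0); rewrite ?inE ?size_tuple.
  by rewrite ip_eq0C; apply: (ou 0); rewrite ?inE ?size_tuple.
split.
  by apply/allP => x /tnthP[i ->]; have /matrixP/(_ i i) := Gu; rewrite !mxE eqxx => ->.
apply/(pairwiseP 0) => i j; rewrite !inE size_tuple => lt_in lt_jn lt_ij.
have /matrixP/(_ (Ordinal lt_in) (Ordinal lt_jn)) := Gu; rewrite !mxE !(tnth_nth 0) /=.
by move=> ->; rewrite -val_eqE /= ltn_eqF.
Qed.

Lemma orthonormal_free s : orthonormal ip s -> free s.
Proof.
move=> s_on; have /orthonormal_gramP Gs : orthonormal ip (in_tuple s) by [].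
change (free (in_tuple s)); apply/freeP => c sum0 j.
have /eqP := congr1 (ip^~ (tnth (in_tuple s) j)) sum0.
rewrite linear0l linear_sumlz (bigD1 j) //= big1 => [|i ne_ij]; last first.
  have /matrixP/(_ i j) := Gs; rewrite !mxE (negPf ne_ij).
  by rewrite ipZl -(tnth_nth 0 (in_tuple s)) => ->; rewrite mulr0.
have /matrixP/(_ j j) := Gs; rewrite !mxE eqxx ipZl -(tnth_nth 0 (in_tuple s)) => ->.
by rewrite mulr1 addr0 => /eqP.
Qed.

(** The orthogonal projection onto the span of s when s is orthonormal. *)
Definition oproj s x := \sum_(y <- s) ip x y *: y.

Fact oproj_is_linear s : linear (oproj s).
Proof.
move=> a x y; rewrite /oproj scaler_sumr -big_split; apply: eq_bigr => z _ /=.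
by rewrite linearPl scalerDl scalerA.
Qed.

HB.instance Definition _ s :=
  GRing.isLinear.Build K X X *:%R (oproj s) (oproj_is_linear s).

Lemma oproj_span s x : oproj s x \in <<s>>%VS.
Proof.
rewrite /oproj big_seq; apply: memv_suml => y ys.
exact/memvZ/memv_span.
Qed.

(** True for every s, as the matrix of the projection is a sum of matrices of
    the form y y^*. *)
Lemma oproj_sym s x y : ip (oproj s x) y = ip x (oproj s y).
Proof.
rewrite /oproj linear_sumlz linear_sumr; apply: eq_bigr => z _ /=.
by rewrite ipZr ipZl mulrC [ip z y]ipC.
Qed.

Lemma orthonormalP s : uniq s ->
  reflect ({in s, forall x, ip x x = 1} /\
           {in s &, forall x y, x != y -> ip x y = 0})
          (orthonormal ip s).
Proof.
move=> s_uniq; rewrite orthonormal_pairwise.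
have ip_sym : symmetric (fun x y => ip x y == 0) by move=> *; apply: ip_eq0C.
apply: (iffP andP) => [[/allP ns /(uniq_pairwiseP ip_sym s_uniq) os]|[ns os]].
  by split=> [x /ns /eqP //|x y xs ys ne_xy]; apply/eqP/os.
split; first by apply/allP => x /ns ->.
by apply/(uniq_pairwiseP ip_sym s_uniq) => x y xs ys ne_xy; apply/eqP/os.
Qed.

Lemma oproj_mem s x : orthonormal ip s -> x \in s -> oproj s x = x.
Proof.
move=> s_on xs; have s_uniq := free_uniq (orthonormal_free s_on).
have [ns os] := orthonormalP s_uniq s_on.
rewrite /oproj (bigD1_seq x) //= ns // scale1r big_seq_cond big1 ?addr0 //.
by move=> y /andP[ys ne_yx]; rewrite os ?scale0r // eq_sym.
Qed.

Lemma oproj_id s x : orthonormal ip s -> x \in <<s>>%VS -> oproj s x = x.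
Proof.
move=> s_on /(coord_span (X := in_tuple s)) {2 1}->.
rewrite linear_sum; apply: eq_bigr => i _; rewrite linearZ /=.
by rewrite oproj_mem // mem_nth.
Qed.

Lemma ip_oproj s x y :
  orthonormal ip s -> y \in <<s>>%VS -> ip (oproj s x) y = ip x y.
Proof. by move=> s_on ys; rewrite oproj_sym oproj_id. Qed.

Definition onb V s := basis_of V s /\ orthonormal ip s.

Lemma onb_mem V s x : onb V s -> x \in s -> x \in V.
Proof. by case=> /basis_mem + _; apply. Qed.

Lemma onb_size V s : onb V s -> size s = \dim V.
Proof. by case=> /(size_basis (X := in_tuple s)) ->. Qed.

Lemma onbP V s :
  orthonormal ip s -> {subset s <= V} -> (\dim V <= size s)%N -> onb V s.
Proof.
move=> s_on sV le_Vs; split=> //.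
by rewrite basisEfree orthonormal_free // le_Vs andbT; apply/span_subvP.
Qed.

Lemma onb_span V s : onb V s -> <<s>>%VS = V.
Proof. by case=> /span_basis. Qed.

Lemma onb_oproj V s x : onb V s -> x \in V -> oproj s x = x.
Proof. by move=> s_onb; rewrite -{1}(onb_span s_onb); apply: oproj_id s_onb.2. Qed.

Lemma onb_perm V s t : perm_eq s t -> onb V s -> onb V t.
Proof.
move=> st [s_basis s_on].
have s_uniq := free_uniq (orthonormal_free s_on); have t_uniq := s_uniq.
rewrite (perm_uniq st) in t_uniq; have [ns os] := orthonormalP s_uniq s_on.
split; first by rewrite -(perm_basis _ st).
apply/(orthonormalP t_uniq); have mem_t := perm_mem st.
by split=> [x|x y]; rewrite -!mem_t; [apply: ns|apply: os].
Qed.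

(** Parseval's identity, in matrix form: inner products with vectors of V can be
    computed through the coordinates on an orthonormal basis of V. Taking u and
    v inside V, it also says that a change of orthonormal bases is unitary. *)
Lemma gram_mull V k m n (w : k.-tuple X) (u : m.-tuple X) (v : n.-tuple X) :
  onb V w -> {subset u <= V} -> gram u v = gram u w *m gram w v.
Proof.
move=> w_onb uV; apply/matrixP => i j; rewrite !mxE.
rewrite -{1}(onb_oproj w_onb (uV _ (mem_tnth i u))) /oproj big_tuple linear_sumlz.
by apply: eq_bigr => l _; rewrite /= ipZl !mxE.
Qed.

Lemma gram_mulr V k m n (w : k.-tuple X) (u : m.-tuple X) (v : n.-tuple X) :
  onb V w -> {subset v <= V} -> gram u v = gram u w *m gram w v.
Proof.
move=> w_onb vV; apply/matrixP => i j; rewrite !mxE.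
rewrite -{1}(onb_oproj w_onb (vV _ (mem_tnth j v))) -oproj_sym /oproj big_tuple.
by rewrite linear_sumlz; apply: eq_bigr => l _; rewrite /= ipZl !mxE.
Qed.

Lemma colsub_gram m n k (u : m.-tuple X) (v : n.-tuple X) (t : k.-tuple 'I_n) :
  colsub (tnth t) (gram u v) = gram u [tuple of map (tnth v) t].
Proof. by apply/matrixP => i j; rewrite !mxE tnth_map. Qed.

Lemma rowsub_gram m n k (u : m.-tuple X) (v : n.-tuple X) (t : k.-tuple 'I_m) :
  rowsub (tnth t) (gram u v) = gram [tuple of map (tnth u) t] v.
Proof. by apply/matrixP => i j; rewrite !mxE tnth_map. Qed.

Lemma onb_coordinate_subspace n k (e : n.-tuple X) (t : k.-tuple 'I_n) :
  orthonormal ip e -> uniq t ->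
  onb (coordinate_subspace e t) [tuple of map (tnth e) t].
Proof.
move=> /orthonormal_gramP Ge t_uniq.
have et_on : orthonormal ip [tuple of map (tnth e) t].
  apply/orthonormal_gramP; rewrite -rowsub_gram -colsub_gram Ge.
  apply/matrixP => i j; rewrite !mxE; congr (_%:R).
  by rewrite (inj_eq (elimT (tuple_uniqP t) t_uniq)).
by split; rewrite // /basis_of (orthonormal_free et_on) andbT eqxx.
Qed.

End InnerProduct.

(** * Existence of principal bases *)
Lemma acos_antitone (R : realType) (x y : R) :
  -1 <= x <= 1 -> -1 <= y <= 1 -> x <= y -> acos y <= acos x.
Proof.
move=> x1 y1 le_xy; have cosI z : -1 <= z <= 1 -> acos z \in `[0, pi].
  by move=> z1; rewrite in_itv /=; case: (acos_def z1).
by rewrite leNgt -ltr_cos ?cosI // !acosK ?in_itv // -leNgt.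
Qed.

(** The real and the complex case are treated together by keeping only what they
    share. The map rho recovers a real number from a nonnegative scalar, so that
    lengths are real. In the real case iota and theta are the identity and
    self-adjoint matrices are symmetric ones. *)
Section PrincipalBases.
Context {R : realType} {K : numFieldType} {iota : {rmorphism R -> K}}
  {theta : {rmorphism K -> K}} (rho : K -> R) {X : vectType K}
  (ip : {dot X for theta}).
Hypotheses (iota_le : {mono iota : a b / a <= b})
  (theta_iota : forall a, theta (iota a) = iota a)
  (rhoK : forall c, 0 <= c -> iota (rho c) = c)
  (hermitian_eigenvalue : forall n (H : 'M[K]_n.+1),
     map_mx theta H^T = H -> exists c, eigenvalue H c).
Implicit Types (s t : seq X) (x y : X) (V W : {vspace X}).

Definition ip_norm x : R := Num.sqrt (rho (ip x x)).

Lemma rho_ge0 c : 0 <= c -> 0 <= rho c.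
Proof. by move=> c_ge0; rewrite -iota_le rmorph0 rhoK. Qed.

Lemma sqr_ip_norm x : iota (ip_norm x ^+ 2) = ip x x.
Proof. by rewrite sqr_sqrtr ?rhoK ?rho_ge0 ?ip_ge0. Qed.

Lemma ip_norm_ge0 x : 0 <= ip_norm x. Proof. exact: sqrtr_ge0. Qed.

Lemma ip_norm_eq0 x : (ip_norm x == 0) = (x == 0).
Proof. by rewrite -sqrf_eq0 -(fmorph_eq0 iota) sqr_ip_norm ip_eq0. Qed.

Lemma ip_norm0 : ip_norm 0 = 0.
Proof. by apply/eqP; rewrite ip_norm_eq0. Qed.

Definition normalize x := iota (ip_norm x)^-1 *: x.

Lemma normalizeK x : iota (ip_norm x) *: normalize x = x.
Proof.
have [->|x_neq0] := eqVneq x 0; first by rewrite /normalize !scaler0.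
by rewrite scalerA -rmorphM divff ?rmorph1 ?scale1r // ip_norm_eq0.
Qed.

Lemma ip_normalize x y :
  ip (normalize x) (normalize y) = iota ((ip_norm x)^-1 * (ip_norm y)^-1) * ip x y.
Proof. by rewrite ipZl ipZr theta_iota mulrA -rmorphM. Qed.

Lemma ip_normalize_id x : x != 0 -> ip (normalize x) (normalize x) = 1.
Proof.
rewrite -ip_norm_eq0 => x_neq0.
by rewrite ip_normalize -sqr_ip_norm -rmorphM -invfM mulVf ?rmorph1 // mulf_neq0.
Qed.

(** Gram-Schmidt, one vector at a time. *)
Lemma onb_extend V s :
  orthonormal ip s -> {subset s <= V} -> exists t, onb ip V (s ++ t).
Proof.
have [n] := ubnP (\dim V - size s); elim: n s => // n IHn s le_n s_on sV.
have [le_Vs|lt_sV] := leqP (\dim V) (size s).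
  by exists [::]; rewrite cats0; apply: onbP.
have [x xV xNs] : exists2 x, x \in V & x \notin <<s>>%VS.
  apply/subvPn/negP => /dimvS; rewrite leqNgt => /negP; apply.
  exact: leq_ltn_trans (dim_span s) lt_sV.
pose y := x - oproj ip s x.
have sVs : (<<s>> <= V)%VS by apply/span_subvP.
have yV : y \in V by rewrite memvB // (subvP sVs) // oproj_span.
have y_neq0 : y != 0.
  by apply: contraNneq xNs => /eqP; rewrite subr_eq0 => /eqP->; apply: oproj_span.
have ys z : z \in s -> ip z y = 0.
  by move=> zs; rewrite ipBr -oproj_sym oproj_mem // subrr.
have [|||t t_onb] := IHn (rcons s (normalize y)).
- rewrite size_rcons -ltnS; apply: leq_trans le_n.
  by rewrite ltnS ltn_sub2l.
- rewrite -cats1 orthonormal_cat s_on orthonormal_pairwise /= ip_normalize_id //.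
  rewrite eqxx; apply/allrelP => z _ zs /[1!inE]/eqP->.
  by rewrite ipZr ys ?mulr0.
- by move=> z; rewrite mem_rcons inE => /predU1P[->|/sV//]; apply: memvZ.
by exists (normalize y :: t); rewrite -cat_rcons.
Qed.

Lemma onb_exists V : exists u : (\dim V).-tuple X, onb ip V u.
Proof.
have [//|//|t t_onb] := @onb_extend V [::].
have size_t : size t == \dim V by rewrite -(onb_size t_onb).
by exists (Tuple size_t).
Qed.

(** The spectral theorem for the compression of T to V. The subspace V need not
    be stable under T; the conclusion only involves inner products within V. An
    eigenvector x of the matrix of T on an orthonormal basis of V satisfies
    <T x, y> = c <x, y> for every y in V, so one can split x off and continue in
    its orthogonal complement in V. *)
Lemma selfadjoint_diagonal (T : {linear X -> X}) V :
  (forall x y, ip (T x) y = ip x (T y)) ->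
  exists2 s, onb ip V s & pairwise (fun x y => ip (T x) y == 0) s.
Proof.
move=> T_sym; have [n] := ubnP (\dim V); elim: n V => // n IHn V le_Vn.
have [V0|V_gt0] := posnP (\dim V).
  by exists [::] => //; apply: onbP; rewrite ?V0.
have [d dV] : exists d, \dim V = d.+1 by exists (\dim V).-1; rewrite prednK.
have := onb_exists V; rewrite dV => -[u u_onb].
pose H : 'M[K]_d.+1 := \matrix_(i, j) ip (T (tnth u i)) (tnth u j).
have [|c /eigenvalueP[v vH v_neq0]] := @hermitian_eigenvalue _ H.
  by apply/matrixP => i j; rewrite !mxE T_sym -ipC.
pose x := \sum_i v 0 i *: tnth u i.
have xV : x \in V.
  by apply: memv_suml => i _; apply/memvZ/(onb_mem u_onb)/mem_tnth.
have ipx j : ip x (tnth u j) = v 0 j.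
  rewrite linear_sumlz (bigD1 j) //= big1 => [|i ne_ij]; rewrite ipZl.
    have /orthonormal_gramP/matrixP/(_ j j) := u_onb.2.
    by rewrite !mxE eqxx => ->; rewrite mulr1 addr0.
  have /orthonormal_gramP/matrixP/(_ i j) := u_onb.2.
  by rewrite !mxE (negPf ne_ij) => ->; rewrite mulr0.
have x_neq0 : x != 0.
  apply: contraNneq v_neq0 => x0; apply/eqP/rowP => j.
  by rewrite -ipx x0 linear0l mxE.
have Tx y : y \in V -> ip (T x) y = c * ip x y.
  move=> /(onb_oproj u_onb) <-; rewrite /oproj !linear_sumr mulr_sumr big_tuple.
  rewrite big_tuple.
  apply: eq_bigr => j _; rewrite /= !ipZr mulrCA ipx; congr (_ * _).
  have /rowP/(_ j) := vH; rewrite !mxE => <-.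
  rewrite linear_sum linear_sumlz; apply: eq_bigr => i _.
  by rewrite linearZ /= ipZl mxE.
have xNorth : x \notin orthov ip V.
  by apply/mem_orthovPn; exists x; rewrite // ip_eq0.
have dimV' := eq_dim_orthov1 xNorth; rewrite dV /= in dimV'.
have [|s s_onb s_diag] := IHn (V :&: orthov ip <[x]>)%VS.
  by rewrite -dimV' -ltnS -dV.
have sP y : y \in s -> y \in V /\ ip x y = 0.
  move=> /(onb_mem s_onb); rewrite memv_cap mem_orthov1 ip_eq0C => /andP[-> /eqP->].
  by [].
exists (normalize x :: s).
  apply: onbP => /=.
  - rewrite -cat1s orthonormal_cat s_onb.2 orthonormal_pairwise /= ip_normalize_id //.
    rewrite eqxx; apply/allrelP => _ y /[1!inE]/eqP-> ys.
    by rewrite ipZl (sP y ys).2 mulr0.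
  - by move=> y; rewrite inE => /predU1P[->|/sP[]//]; apply: memvZ.
  by rewrite (onb_size s_onb) -dimV' dV.
rewrite /= s_diag andbT; apply/allP => y /sP[yV xy0].
by rewrite linearZ /= ipZl Tx // xy0 !mulr0.
Qed.

(** Bessel's inequality: the squared distance from x to its projection is
    nonnegative. *)
Lemma ip_norm_oproj_le1 s x :
  orthonormal ip s -> ip x x = 1 -> ip_norm (oproj ip s x) <= 1.
Proof.
move=> s_on x1; rewrite -(@ler_pXn2r _ 2) ?nnegrE ?ip_norm_ge0 // expr1n.
rewrite -iota_le rmorph1 sqr_ip_norm -subr_ge0 -x1.
suff -> : ip x x - ip (oproj ip s x) (oproj ip s x)
  = ip (x - oproj ip s x) (x - oproj ip s x) by apply: ip_ge0.
have ipPP : ip (oproj ip s x) (oproj ip s x) = ip x (oproj ip s x).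
  by rewrite ip_oproj ?oproj_span.
rewrite ipBl !ipBr ipPP oproj_sym.
by rewrite subrr subr0.
Qed.

(** With P the projection onto W and e diagonalising P on V, one has
    <P e_i, P e_j> = <P e_i, e_j> = 0 for i != j, so the nonzero P e_i become
    orthonormal vectors of W when normalised. Sorting e by decreasing length of
    P e_i makes the angles increase and puts the vectors with P e_i = 0 last;
    those have angle pi / 2, and the remaining vectors of the basis of W can be
    chosen freely. *)
Lemma principal_bases_exist V W :
  exists e f th, principal_bases (V := V) (W := W) iota ip e f th.
Proof.
have [w w_onb] := onb_exists W; pose P : {linear X -> X} := oproj ip w.
have Psym x y : ip (P x) y = ip x (P y) by apply: oproj_sym.
have [s s_onb s_diag] := selfadjoint_diagonal V Psym.
have PW x : P x \in W by rewrite -(onb_span w_onb) oproj_span.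
have Pid x : x \in W -> P x = x by apply: onb_oproj w_onb.
have s_uniq := free_uniq (orthonormal_free s_onb.2).
have ipP0 : {in s &, forall x y, x != y -> ip (P x) y = 0}.
  have P_sym : symmetric (fun x y => ip (P x) y == 0).
    by move=> x y; rewrite ip_eq0C -Psym.
  have diag := elimT (uniq_pairwiseP P_sym s_uniq) s_diag.
  by move=> x y xs ys ne_xy; apply/eqP/diag.
pose leP x y := ip_norm (P y) <= ip_norm (P x).
pose s1 := sort leP [seq x <- s | P x != 0]; pose s2 := [seq x <- s | P x == 0].
pose e := s1 ++ s2.
have e_perm : perm_eq s e.
  rewrite -(perm_filterC (fun x => P x != 0)) perm_cat //.
    by rewrite perm_sym perm_sort.
  by rewrite (eq_filter (a2 := fun x => P x == 0)) // => x; rewrite /= negbK.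
have e_onb := onb_perm e_perm s_onb.
have leP_total : total leP by move=> x y; apply: le_total.
have leP_trans : transitive leP.
  by move=> y x z le_yx le_zy; apply: le_trans le_zy le_yx.
have mem_s1 x : (x \in s1) = (P x != 0) && (x \in s) by rewrite mem_sort mem_filter.
have mem_s2 x : (x \in s2) = (P x == 0) && (x \in s) by rewrite mem_filter.
have e_sorted : sorted leP e.
  rewrite sorted_pairwise // pairwise_cat -!sorted_pairwise // sort_sorted //=.
  apply/andP; split.
    apply/allrelP => x y _; rewrite mem_s2 => /andP[/eqP Py0 _].
    by rewrite /leP Py0 ip_norm0 ip_norm_ge0.
  rewrite sorted_pairwise //; apply/(pairwiseP 0) => i j lt_i lt_j _.
  have := mem_nth 0 lt_i; have := mem_nth 0 lt_j; rewrite !mem_s2 /leP.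
  by move=> /andP[/eqP -> _] /andP[/eqP -> _].
have [|x|t f_onb] := @onb_extend W (map (normalize \o P) s1).
- rewrite orthonormal_pairwise all_map pairwise_map; apply/andP; split.
    by apply/allP => x /=; rewrite mem_s1 => /andP[Px _]; rewrite ip_normalize_id.
  apply/uniq_pairwiseP; first by move=> x y; rewrite /= ip_eq0C.
    by rewrite sort_uniq filter_uniq.
  move=> x y; rewrite !mem_s1 => /andP[_ xs] /andP[_ ys] ne_xy /=.
  by rewrite ip_normalize -Psym (Pid _ (PW x)) ipP0 // mulr0.
- by case/mapP => y _ ->; apply: memvZ.
set f := _ ++ t in f_onb.
have size_e : size e == \dim V by rewrite (onb_size e_onb).
have size_f : size f == \dim W by rewrite (onb_size f_onb).
have ip_norm01 i : (i < \dim V)%N -> 0 <= ip_norm (P e`_i) <= 1.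
  move=> lt_i; rewrite ip_norm_ge0 ip_norm_oproj_le1 ?w_onb.2 //.
  have /orthonormalP[|+ _] := e_onb.2; first by rewrite -(perm_uniq e_perm).
  by apply; rewrite mem_nth ?(eqP size_e).
have norm11 i : (i < \dim V)%N -> -1 <= ip_norm (P e`_i) <= 1.
  by move/ip_norm01/andP=> [ge0 ->]; rewrite (le_trans _ ge0) ?lerN10.
pose th : (minn (\dim V) (\dim W)).-tuple R := [tuple acos (ip_norm (P e`_i)) | i < _].
have thE i : (i < minn (\dim V) (\dim W))%N -> th`_i = acos (ip_norm (P e`_i)).
  by move=> lt_i; rewrite (nth_mktuple _ _ (Ordinal lt_i)).
exists (Tuple size_e), (Tuple size_f), th; split=> //; first split.
- apply/(sortedP 0) => i; rewrite size_tuple => lt_i1.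
  have lt_i := ltnW lt_i1; rewrite !thE //.
  move: (lt_i1) (lt_i); rewrite !leq_min => /andP[ltV1 _] /andP[ltV _].
  rewrite acos_antitone ?norm11 //.
  by apply: (sortedP 0 e_sorted); rewrite (eqP size_e).
- move=> _ /tnthP[i ->]; rewrite tnth_mktuple.
  have /andP[lt_i _] : (i < \dim V)%N && (i < \dim W)%N by rewrite -leq_min.
  have /andP[ge0 _] := ip_norm01 _ lt_i.
  by rewrite acos_ge0 ?norm11 // -acos0 acos_antitone ?norm11 // lerN10 ler01.
(* As f_j lies in W, the inner product of f_j and e_i is that of f_j and P e_i,
   and P e_i is either a multiple of f_i or zero. *)
move=> i j; rewrite !(tnth_nth 0) /=.
have fjW : f`_j \in W by rewrite (onb_mem f_onb) // mem_nth // (eqP size_f).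
have ff l : (l < \dim W)%N -> ip f`_j f`_l = (j == l :> nat)%:R.
  move=> lt_l; have /(orthonormal_gramP ip (Tuple size_f))/matrixP := f_onb.2.
  by move=> /(_ j (Ordinal lt_l)); rewrite !mxE !(tnth_nth 0).
rewrite -(Pid _ fjW) Psym.
have [lt_i|le_i] := ltnP i (size s1).
  have f_i : iota (ip_norm (P e`_i)) *: f`_i = P e`_i.
    by rewrite !nth_cat size_map lt_i (nth_map 0) //= normalizeK.
  have lt_iW : (i < \dim W)%N.
    by apply: leq_trans lt_i _; rewrite -(eqP size_f) size_cat size_map leq_addr.
  rewrite -f_i ipZr theta_iota ff // eq_sym; case: eqP => _; last by rewrite mulr0.
  by rewrite mulr1 thE ?leq_min ?ltn_ord // acosK // in_itv /= norm11.
have Pe0 : P e`_i = 0.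
  have : e`_i \in s2.
    rewrite nth_cat ltnNge le_i /= mem_nth // ltn_subLR //.
    by rewrite -size_cat (eqP size_e).
  by rewrite mem_s2 => /andP[/eqP].
rewrite Pe0 linear0r; case: eqP => // eq_ij.
have lt_i : (i < minn (\dim V) (\dim W))%N by rewrite leq_min ltn_ord eq_ij ltn_ord.
rewrite thE // Pe0 ip_norm0.
by rewrite acosK ?rmorph0 // in_itv /= lerN10 ler01.
Qed.

(** * The Grassmann angle as a Gram determinant *)
Lemma principal_bases_gram V W e f th :
  principal_bases (V := V) (W := W) iota ip e f th ->
  gram ip e f *m gram ip f e =
    diag_mx (\row_i if (i < \dim W)%N then iota (cos th`_i ^+ 2) else 0).
Proof.
move=> [_ _ _ ip_fe]; apply/matrixP => i j; rewrite !mxE.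
under eq_bigr do rewrite !mxE ipC !ip_fe.
case: ifPn => [lt_iW|le_Wi]; last first.
  rewrite mul0rn big1 // => l _; case: eqP => [eq_il|_]; last by rewrite rmorph0 mul0r.
  by rewrite eq_il ltn_ord in le_Wi.
rewrite (bigD1 (Ordinal lt_iW)) //= eqxx theta_iota big1 => [|l].
  rewrite addr0 -val_eqE /= eq_sym; case: eqP => [->|_]; last by rewrite mulr0.
  by rewrite -rmorphM.
by rewrite -val_eqE /= eq_sym => /negPf ->; rewrite rmorph0 mul0r.
Qed.

Lemma principal_anglesP V W :
  exists e f,
    principal_bases (V := V) (W := W) iota ip e f (principal_angles iota ip V W).
Proof.
apply: (@classical_sets.xgetPex _ _ (fun th => exists e f, principal_bases iota ip e f th)).
by have [e [f [th pb]]] := principal_bases_exist V W; exists th, e, f.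
Qed.

(** The basis-free form of the squared cosine: the right-hand side has the same
    value for all orthonormal bases, and for dim V <= dim W its value on
    principal bases is the product of the squared cosines of the principal
    angles. *)
Lemma sqr_cos_grassmann_angle V W m n (v : m.-tuple X) (w : n.-tuple X) :
  onb ip V v -> onb ip W w ->
  iota (cos (grassmann_angle iota ip V W) ^+ 2) = \det (gram ip v w *m gram ip w v).
Proof.
move=> v_onb w_onb; have dimV := onb_size v_onb; have dimW := onb_size w_onb.
rewrite size_tuple in dimV; rewrite size_tuple in dimW; subst m n.
rewrite /grassmann_angle; case: eqP => [V0|_].
  rewrite cos0 expr1n rmorph1 /gram; move: (_ *m _).
  by rewrite V0 dimv0 => M; rewrite det_mx00.
case: ifPn => [le_VW|]; last first.
  by rewrite -ltnNge => lt_WV; rewrite cos_pihalf expr0n rmorph0 det_mulmx_lt.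
have [e [f]] := principal_anglesP V W.
move: (principal_angles _ _ _ _) => th pb.
have [e_onb f_onb [_ th01] _] := pb.
have vV x : x \in v -> x \in V by apply: onb_mem v_onb.
have eV x : x \in e -> x \in V by apply: onb_mem e_onb.
have wW x : x \in w -> x \in W by apply: onb_mem w_onb.
have fW x : x \in f -> x \in W by apply: onb_mem f_onb.
have Gff : gram ip f w *m gram ip w f = 1%:M.
  by rewrite -(gram_mull _ w_onb fW); apply/orthonormal_gramP; case: f_onb.
have Gvv : gram ip v e *m gram ip e v = 1%:M.
  by rewrite -(gram_mull _ e_onb vV); apply/orthonormal_gramP; case: v_onb.
(* Passing from w to f is absorbed by the unitarity of their Gram matrix, and
   passing from v to e conjugates the product by a unitary matrix. *)
have -> : gram ip v w *m gram ip w v =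
    gram ip v e *m (gram ip e f *m gram ip f e) *m gram ip e v.
  rewrite (gram_mull w e_onb vV) (gram_mulr e f_onb wW).
  rewrite (gram_mulr w e_onb vV) (gram_mull e f_onb wW) -!mulmxA; congr (_ *m (_ *m _)).
  by rewrite mulmxA Gff mul1mx.
rewrite [in RHS]det_mulmx [in RHS]det_mulmx mulrAC -det_mulmx Gvv det1 mul1r.
rewrite (principal_bases_gram pb) det_diag.
have cos01 a : a \in th -> 0 <= cos a <= 1.
  move=> /th01/andP[a_ge0 a_le]; rewrite cos_le1 cos_ge0_pihalf // a_le.
  by rewrite (le_trans _ a_ge0) // oppr_le0 divr_ge0 ?pi_ge0.
have prod01 : 0 <= \prod_(t <- th) cos t <= 1.
  by rewrite big_seq prodr_ge0 ?prodr_ile1 // => t /cos01/andP[].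
have [prod0 prod1] := andP prod01.
rewrite acosK; last by rewrite in_itv /= prod1 (le_trans _ prod0) ?lerN10.
have size_th : size th = \dim V by rewrite size_tuple (minn_idPl le_VW).
rewrite -prodrXl rmorph_prod (big_nth 0) size_th big_mkord.
by apply: eq_bigr => i _; rewrite mxE (leq_trans (ltn_ord i) le_VW).
Qed.

(** * The sum over coordinate subspaces *)

(** The Gram matrix of U and W factors through the principal basis e of V, and
    the middle factor is diagonal because e is principal; this is what kills the
    mixed products of minors that Cauchy-Binet would give for a general basis of
    V. *)
Lemma sqr_cos_coordinate_sum V W U (e : (\dim V).-tuple X) :
  (U <= V)%VS -> principal_basis iota ip W e ->
  cos (grassmann_angle iota ip U W) ^+ 2 =
    \sum_(t : (\dim U).-tuple 'I_(\dim V) | increasing t)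
      cos (grassmann_angle iota ip U (coordinate_subspace e t)) ^+ 2 *
      cos (grassmann_angle iota ip (coordinate_subspace e t) W) ^+ 2.
Proof.
move=> sUV [f [th pb]]; have [e_onb f_onb _ _] := pb.
have [u u_onb] := onb_exists U.
have uV x : x \in u -> x \in V by move=> /(onb_mem u_onb); apply: subvP.
apply: (fmorph_inj iota); rewrite rmorph_sum.
rewrite (sqr_cos_grassmann_angle u_onb f_onb) /=.
rewrite (gram_mull f e_onb uV) (gram_mulr f e_onb uV) mulmxA -(mulmxA (gram ip u e)).
rewrite -mulmxA Cauchy_Binet; apply: eq_bigr => t t_incr.
have t_uniq := increasing_uniq t_incr.
have et_onb := onb_coordinate_subspace e_onb.2 t_uniq.
rewrite rmorphM /= (sqr_cos_grassmann_angle u_onb et_onb).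
rewrite (sqr_cos_grassmann_angle et_onb f_onb) (principal_bases_gram pb).
rewrite rowsub_diag_mul // -(principal_bases_gram pb) mxsub_mul.
rewrite !rowsub_gram !colsub_gram !det_mulmx.
by rewrite mulrA mulrAC.
Qed.

End PrincipalBases.

(** Over the complex numbers H has an eigenvalue c, with eigenvector v. Computing
    v H v^* in two ways gives c |v|^2 = c^* |v|^2, so c is real and is already
    an eigenvalue over R. *)
Lemma symmetric_eigenvalue (R : rcfType) n (H : 'M[R]_n.+1) :
  H^T = H -> exists c, eigenvalue H c.
Proof.
move=> H_sym; pose HC := map_mx (real_complex R) H.
have [c c_eig] := eigenvalue_closed HC (ltn0Sn n).
have /eigenvalueP[v vH v_neq0] := c_eig.
pose q := (v *m (map_mx Num.conj v)^T) 0 0.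
have q_neq0 : q != 0.
  apply: contraNneq v_neq0 => /eqP.
  rewrite /q mxE psumr_eq0 => [/allP v0|i _]; last by rewrite !mxE mul_conjC_ge0.
  apply/eqP/rowP => i; have := v0 i (mem_index_enum i).
  by rewrite !mxE mul_conjC_eq0 => /eqP.
have HC_conj : map_mx Num.conj HC = HC.
  apply/matrixP => i j; rewrite !mxE; apply/conj_Creal/complex_realP.
  by exists (H i j).
have HC_sym : HC^T = HC by rewrite /HC map_trmx H_sym.
have vHv : c * q = Num.conj c * q.
  transitivity ((v *m HC *m (map_mx Num.conj v)^T) 0 0).
    by rewrite vH -scalemxAl mxE.
  rewrite -mulmxA.
  have -> : HC *m (map_mx Num.conj v)^T = (map_mx Num.conj (v *m HC))^T.
    by rewrite map_mxM trmx_mul HC_conj HC_sym.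
  by rewrite vH map_mxZ linearZ /= -scalemxAr mxE.
have /esym/CrealP/complex_realP[a ca] := mulIf q_neq0 vHv.
by exists a; rewrite -(eigenvalue_map (real_complex R)) /= -ca.
Qed.

Theorem theorem8p5 (R : realType) :
  (* real case *)
  (forall (X : vectType R) (ip : {dot X for idfun}) (V W U : {vspace X})
      (e : (\dim V).-tuple X),
    V != 0%VS -> W != 0%VS -> (U <= V)%VS ->
    principal_basis idfun ip W e ->
    let Theta := grassmann_angle idfun ip in
    cos (Theta U W) ^+ 2 =
    \sum_(i : (\dim U).-tuple 'I_(\dim V) | increasing i)
      cos (Theta U (coordinate_subspace e i)) ^+ 2 *
      cos (Theta (coordinate_subspace e i) W) ^+ 2)
  /\
  (* complex case *)
  (forall (X : vectType R[i]) (ip : {dot X for Num.conj}) (V W U : {vspace X})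
      (e : (\dim V).-tuple X),
    V != 0%VS -> W != 0%VS -> (U <= V)%VS ->
    principal_basis (real_complex R) ip W e ->
    let Theta := grassmann_angle (real_complex R) ip in
    cos (Theta U W) ^+ 2 =
    \sum_(i : (\dim U).-tuple 'I_(\dim V) | increasing i)
      cos (Theta U (coordinate_subspace e i)) ^+ 2 *
      cos (Theta (coordinate_subspace e i) W) ^+ 2).
Proof.
split=> X ip V W U e _ _ sUV pb.
  apply: (@sqr_cos_coordinate_sum R R idfun idfun id) => // n H.
  by rewrite map_mx_id => // /symmetric_eigenvalue.
apply: (@sqr_cos_coordinate_sum R R[i] (real_complex R) Num.conj (@complex.Re R)) => //.
- by move=> a b; rewrite lecR.
- by move=> a; apply/conj_Creal/complex_realP; exists a.
- by move=> c /ger0_real /RRe_real.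
- by move=> n H _; apply: eigenvalue_closed.
Qed.
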